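(* Let $p\ge2$ be an integer and let $Z=(Z_n(t))_{n\in\mathbb{Z}_+^p}$ be a sequence of complex random variables on $[0,1]$ such that, for every $n$, $|Z_n(t)|\ge1$ for almost all $t\in[0,1]$. Then there exist an analytic function $f\in\mathcal{A}^p$, $f(z)=\sum_{\|n\|=0}^{+\infty}a_nz^n$, and a constant $C>0$ such that for almost every $t\in[0,1]$ there is a set $E=E(f,t)\subset[0,1)^p$ with $E\notin\Upsilon$ such that for all $r\in E$ $$M_f(r,t)\geq C\mu_f(r)\prod_{j=1}^p\frac{1}{\sqrt{1-r_j}}\cdot\ln^{p/4}\Biggl\{\mu_f(r)\prod_{j=1}^p\frac{1}{1-r_j}\Biggr\},$$ where $$f(z,t)=\sum_{\|n\|=0}^{+\infty}a_nZ_n(t)z_1^{n_1}\cdots z_p^{n_p},\qquad M_f(r,t)=\max\{|f(z,t)|\colon |z_j|\le r_j,\ j\in\{1,\ldots,p\}\}.$$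
   Context: Notation: $\mathbb{D}^p=\{z\in\mathbb{C}^p\colon |z_j|<1,\ j\in\{1,\ldots,p\}\}$; for $n=(n_1,\ldots,n_p)\in\mathbb{Z}_+^p$ (nonnegative integer multi-indices), $\|n\|=n_1+\cdots+n_p$, $z^n=z_1^{n_1}\cdots z_p^{n_p}$, $r^n=r_1^{n_1}\cdots r_p^{n_p}$. $\ln^{a}x$ means $(\ln x)^a$. $\mathcal{A}^p$ is the class of analytic functions represented by power series $f(z)=\sum_{\|n\|=0}^{+\infty}a_nz^n$ (with $a_n\in\mathbb{C}$) whose domain of convergence is $\mathbb{D}^p$. Maximal term: for $r=(r_1,\ldots,r_p)\in[0,1)^p$, $\mu_f(r)=\max\{|a_n|r^n\colon n\in\mathbb{Z}_+^p\}$, where $a_n$ are the coefficients of the (deterministic) function $f$. Sets of asymptotically finite logarithmic measure: for $r_0\in[0,1)^p$ let $\triangle_{r_0}=\{t\in[0,1)^p\colon t_j\ge (r_0)_j,\ j\in\{1,\ldots,p\}\}$. A Lebesgue measurable set $E\subset[0,1)^p$ belongs to $\Upsilon$ if there exists $r_0\in[0,1)^p$ such that $$\int\cdots\int_{E\cap\triangle_{r_0}}\prod_{i=1}^p\frac{dr_i}{1-r_i}<+\infty.$$ Thus $E\notin\Upsilon$, for measurable $E$, means that this integral is $+\infty$ for every $r_0\in[0,1)^p$. Probability: random variables are defined on $\Omega=[0,1]$ with the $\sigma$-algebra of Lebesgue measurable sets and Lebesgue measure. Convention: $M_f(r,t)=+\infty$ if the power series $f(\cdot,t)$ does not converge absolutely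 on $\{z\colon |z_j|\le r_j,\ j\in\{1,\ldots,p\}\}$. *)

(* Defs.v *)
From HB Require Import structures.
From mathcomp Require Import all_boot all_order all_algebra.
From mathcomp Require Import complex.
From mathcomp Require Import all_classical all_reals all_analysis.

Set Implicit Arguments.
Unset Strict Implicit.
Unset Printing Implicit Defensive.
Import Order.TTheory GRing.Theory Num.Theory.
Import numFieldNormedType.Exports.
Import Normc.

Local Open Scope classical_set_scope.
Local Open Scope ring_scope.

Section LebesgueProduct.
Context {R : realType}.

Definition pcons p (x : measurableTypeR R * p.-tuple R) : p.+1.-tuple R :=
  [tuple of x.1 :: x.2].

Definition puncons p (t : p.+1.-tuple R) : measurableTypeR R * p.-tuple R :=
  (thead t, [tuple of behead t]).

Lemma measurable_pcons p : measurable_fun setT (@pcons p).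
Proof. exact: measurable_cons. Qed.

Lemma measurable_puncons p : measurable_fun setT (@puncons p).
Proof.
apply: measurable_fun_pair; last exact: measurable_behead.
exact: (@measurable_tnth _ R p.+1 ord0).
Qed.

Lemma pconsK p : cancel (@pcons p) (@puncons p).
Proof. by move=> [x t]; congr pair; apply/val_inj. Qed.

Lemma punconsK p : cancel (@puncons p) (@pcons p).
Proof. by move=> t; rewrite [RHS]tuple_eta. Qed.

Section step.
Context p (m : {sigma_finite_measure set (p.-tuple R) -> \bar R}).

Definition lebesgue_cons : set (p.+1.-tuple R) -> \bar R :=
  pushforward (lebesgue_measure \x m)%E (@pcons p).

Let lebesgue_cons0 : lebesgue_cons set0 = 0%E.
Proof. by rewrite /lebesgue_cons /pushforward preimage_set0 measure0. Qed.

Let lebesgue_cons_ge0 A : (0 <= lebesgue_cons A)%E.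
Proof. by have mcons := @measurable_pcons p; exact: measure_ge0. Qed.

Let lebesgue_cons_additive : semi_sigma_additive lebesgue_cons.
Proof.
have mcons := @measurable_pcons p.
exact: (@measure_semi_sigma_additive _ _ _
  (pushforward (lebesgue_measure \x m)%E (@pcons p))).
Qed.

HB.instance Definition _ := isMeasure.Build _ _ _ lebesgue_cons
  lebesgue_cons0 lebesgue_cons_ge0 lebesgue_cons_additive.

Let lebesgue_cons_sigma_finite : sigma_finite setT lebesgue_cons.
Proof.
have /sigma_finiteP[F [TF ndF Foo]] :=
  sigma_finiteT (@lebesgue_measure R : {sigma_finite_measure set _ -> \bar R}).
have /sigma_finiteP[G [TG ndG Goo]] := sigma_finiteT m.
exists (fun k => @puncons p @^-1` (F k `*` G k)).
  rewrite -preimage_bigcup -[LHS](preimage_setT (@puncons p)); congr (_ @^-1` _).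
  rewrite -setXTT TF TG predeqE => -[x y]; split.
    move=> [/= [n _ Fnx] [k _ Gky]]; exists (maxn n k) => //; split.
    - by move: x Fnx; exact/subsetPset/ndF/leq_maxl.
    - by move: y Gky; exact/subsetPset/ndG/leq_maxr.
  by move=> [n _ []/= ? ?]; split; exists n.
move=> k; have [mF Fk] := Foo k; have [mG Gk] := Goo k; split.
  rewrite -[X in measurable X]setTI; apply: measurable_puncons => //.
  exact: measurableX.
rewrite /lebesgue_cons /pushforward -comp_preimage.
rewrite (_ : _ \o _ = id) ?preimage_id; last by apply/funext => x /=; rewrite pconsK.
by rewrite product_measure1E// lte_mul_pinfty// ge0_fin_numE.
Qed.

HB.instance Definition _ := Measure_isSigmaFinite.Build _ _ _ lebesgue_cons
  lebesgue_cons_sigma_finite.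

End step.

(* Lebesgue measure on the Borel sets of R^p, as an iterated product. *)
Fixpoint lebesgue_tuple p : {sigma_finite_measure set (p.-tuple R) -> \bar R} :=
  match p with
  | 0 => @dirac _ (0.-tuple R) [tuple] R
  | p'.+1 => lebesgue_cons (lebesgue_tuple p')
  end.

End LebesgueProduct.

(* Lebesgue measure on the Lebesgue measurable sets of R^p, obtained from the
   Borel one in the same way as the library's completed_lebesgue_measure. *)
Definition completed_lebesgue_tuple (R : realType) p :=
  @completed_measure_extension _ _ _ (@lebesgue_tuple R p).
Arguments completed_lebesgue_tuple : clear implicits.

HB.instance Definition _ (R : realType) p :=
  Measure.on (completed_lebesgue_tuple R p).

Definition lebesgue_measurable (R : realType) p (E : set (p.-tuple R)) : Prop :=
  ((lebesgue_tuple p)^*%mu).-cara.-measurable E.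

Section Upsilon.
Context {R : realType} {p : nat}.
Implicit Types (r t : p.-tuple R) (E : set (p.-tuple R)).

(* [0,1)^p *)
Definition unit_cube : set (p.-tuple R) :=
  [set r | forall j, 0 <= tnth r j < 1].

Definition triangle r0 : set (p.-tuple R) :=
  [set t | unit_cube t /\ forall j, tnth r0 j <= tnth t j].

Definition log_measure E : \bar R :=
  (\int[completed_lebesgue_tuple R p]_(r in E) (\prod_(i < p) (1 - tnth r i)^-1)%:E)%E.

Definition Upsilon : set (set (p.-tuple R)) :=
  [set E | [/\ E `<=` unit_cube, lebesgue_measurable E &
    exists2 r0, unit_cube r0 & (log_measure (E `&` triangle r0) < +oo)%E]].

End Upsilon.

Section PowerSeries.
Context {R : realType} {p : nat}.
Implicit Types (n : p.-tuple nat) (z : 'rV[R[i]^o]_p) (r : p.-tuple R)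
  (a : p.-tuple nat -> R[i]).

Definition mdegree n : nat := (\sum_(j < p) tnth n j)%N.

Definition zmonom z n : R[i] := \prod_(j < p) z ord0 j ^+ tnth n j.

Definition rmonom r n : R := \prod_(j < p) tnth r j ^+ tnth n j.

Definition absolutely_convergent a z : Prop :=
  (\esum_(n in [set: p.-tuple nat]) (normc (a n * zmonom z n))%:E < +oo)%E.

(* Summation by total degree; only used where the series converges absolutely. *)
Definition powser a z : R[i] :=
  limn (fun N : nat => \sum_(n \in [set n | (mdegree n < N)%N]) a n * zmonom z n : R[i]^o).

Definition polydisc : set 'rV[R[i]^o]_p := [set z | forall j, normc (z ord0 j) < 1].

Definition closed_polydisc r : set 'rV[R[i]^o]_p :=
  [set z | forall j, normc (z ord0 j) <= tnth r j].

(* A power series is identified with its family of coefficients. Its domain of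
   convergence is the interior of its set of points of absolute convergence.
   R[i]^o is R[i] with the topology given by its modulus. *)
Definition classA a : Prop := (absolutely_convergent a)° = polydisc.

(* For a in classA and r in [0,1)^p the supremum is attained. *)
Definition max_term a r : R := sup [set normc (a n) * rmonom r n | n in setT].

(* In the first case the supremum is attained, by continuity on a compact set;
   it is a supremum of a possibly empty set only if some r_j < 0. *)
Definition max_modulus a r : \bar R :=
  if `[< closed_polydisc r `<=` absolutely_convergent a >]
  then ereal_sup [set (normc (powser a z))%:E | z in closed_polydisc r]
  else +oo%E.

End PowerSeries.

(* R with the sigma-algebra of Lebesgue measurable sets, i.e. the carrier of
   completed_lebesgue_measure. *)
Definition lebesgueType (R : realType) : measurableType _ :=
  caratheodory_type ((@wlength R idfun)^*)%mu.

(* The sample space Omega = [0,1]. Random variables are total functions on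
   lebesgueType R of which only the restriction to this set matters. *)
Definition unit_interval (R : realType) : set (lebesgueType R) := `[0%R, 1%R].
Arguments unit_interval : clear implicits.

Definition complex_random_variable (R : realType) (X : lebesgueType R -> R[i]) :
    Prop :=
  measurable_fun (unit_interval R) (fun t => complex.Re (X t)) /\
  measurable_fun (unit_interval R) (fun t => complex.Im (X t)).

(* Main.v *)
(** With a_n = prod_j exp (2 sqrt n_j) and s_j = - ln r_j, each factor of the
    term of index n is exp (2 sqrt n_j - n_j s_j)
    = exp (1 / s_j) exp (- s_j (sqrt n_j - 1 / s_j)^2), so the maximal term is at
    most prod_j exp (1 / s_j), and about s_j^(-3/2) consecutive values of n_j
    come within a factor e of the maximum. No randomness is needed: as soon as
    all |Z_n(t)| >= 1, Parseval's identity on the torus |z_j| = r_j gives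
    M_f(r, t)^2 >= sum_n a_n^2 r^(2n) >= c prod_j exp (2 / s_j) s_j^(-3/2),
    that is, a gain of prod_j (1 - r_j)^(-1/2) (1 - r_j)^(-1/4) over the maximal
    term. The logarithm in the claim is of order sum_j 1 / (1 - r_j), and its
    power p/4 is at most a constant times prod_j (1 - r_j)^(-1/4) wherever the
    1 - r_j are comparable to each other. So E can be the union of the dyadic
    boxes 2^-(k+1) < 1 - r_j <= 2^-k (for all j): each has logarithmic measure
    at least 2^-p, hence E is not in Upsilon. *)
Require Import Defs.
From mathcomp Require Import all_boot all_order all_algebra.
From mathcomp Require Import complex.
From mathcomp Require Import all_classical all_reals all_analysis.
From mathcomp Require Import cyclic separable cyclotomic measurable_realfun ring lra.

Set Implicit Arguments.
Unset Strict Implicit.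
Unset Printing Implicit Defensive.
Import Order.TTheory GRing.Theory Num.Theory.
Import numFieldNormedType.Exports.
Import Normc.

Local Open Scope classical_set_scope.
Local Open Scope ring_scope.

(** * Parseval's identity at roots of unity *)

(** X^M - 1 splits into distinct linear factors in characteristic 0, and among M distinct M-th roots
    of unity in a field one is primitive. *)
Lemma primitive_root_exists (C : numClosedFieldType) M :
  (0 < M)%N -> exists w : C, M.-primitive_root w.
Proof.
pose P : {poly C} := 'X^M - 1; have [s Ps] := closed_field_poly_normal P.
move=> M_gt0; rewrite (monicP _) ?monicXnsubC // scale1r in Ps.
have s1 : all M.-unity_root s by apply/allP=> z; rewrite -root_prod_XsubC -Ps.
have sz_s : (M < (size s).+1)%N.
  by rewrite -(size_prod_XsubC s id) -Ps size_XnsubC.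
have [|z] := hasP (has_prim_root M_gt0 s1 _ sz_s); last by exists z.
by rewrite -separable_prod_XsubC -Ps separable_Xn_sub_1 // pnatr_eq0 -lt0n.
Qed.

Section RootsOfUnity.
Context (C : numClosedFieldType) (M : nat) (w : C) (w_prim : M.-primitive_root w).

Lemma norm_prim_root : `|w| = 1.
Proof.
apply/eqP; rewrite -(@pexpr_eq1 _ _ M) ?normr_ge0 ?(prim_order_gt0 w_prim)//.
by rewrite -normrX (prim_expr_order w_prim) normr1.
Qed.

(** A geometric sum of ratio z = w^(i - j): z^M = 1, and z = 1 only for i = j because both exponents
    are below M. *)
Lemma prim_root_orthogonal i j : (i < M)%N -> (j < M)%N ->
  \sum_(k < M) (w ^+ k) ^+ i * ((w ^+ k) ^+ j)^* = (M * (i == j))%:R.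
Proof.
move=> iM jM.
have ww : w * w^* = 1 by rewrite -normCK norm_prim_root expr1n.
have w0 : w != 0 by rewrite -normr_gt0 norm_prim_root.
have wV : w^* = w^-1 by apply: (mulfI w0); rewrite ww divff.
pose z := w ^+ i * w ^- j.
have -> : \sum_(k < M) (w ^+ k) ^+ i * ((w ^+ k) ^+ j)^* = \sum_(k < M) z ^+ k.
  apply: eq_bigr => k _; rewrite !rmorphXn /= wV /z exprMn !exprVn.
  by rewrite -!exprM ![(k * _)%N]mulnC.
have [ij|ij] := eqVneq i j.
  rewrite muln1 (eq_bigr (fun=> 1)); first by rewrite sumr_const card_ord.
  by move=> k _; rewrite /z ij divff ?expf_neq0// expr1n.
have z1 : z != 1.
  apply: contra ij => /eqP zE.
  rewrite -(modn_small iM) -(modn_small jM) -(eq_prim_root_expr w_prim).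
  by rewrite -[X in _ == X]mul1r -zE mulfVK// expf_neq0.
have zM : z ^+ M = 1.
  rewrite /z exprMn exprVn -!exprM mulnC [(j * M)%N]mulnC !exprM.
  by rewrite (prim_expr_order w_prim) !expr1n invr1 mulr1.
rewrite muln0; apply/eqP; have := subrX1 z M; rewrite zM subrr => /esym/eqP.
by rewrite mulf_eq0 subr_eq0 (negbTE z1).
Qed.

Context (p : nat).
Implicit Types (n m : p.-tuple nat) (k : {ffun 'I_p -> 'I_M}).

(** The functions k index a grid of M^p points on the torus, over which finite sums replace
    integration. *)
Definition root_monom k n : C := \prod_(j < p) (w ^+ k j) ^+ tnth n j.

(** The sum over the grid factors into one sum per coordinate, and a coordinate where n and m differ
    makes the product vanish. *)
Lemma root_monom_orthogonal n m :
  (forall j, tnth n j < M)%N -> (forall j, tnth m j < M)%N ->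
  \sum_k root_monom k n * (root_monom k m)^* = (M ^ p * (n == m))%:R.
Proof.
move=> nM mM.
under eq_bigr do rewrite /root_monom rmorph_prod -big_split /=.
rewrite -(bigA_distr_bigA
  (fun j (l : 'I_M) => (w ^+ l) ^+ tnth n j * ((w ^+ l) ^+ tnth m j)^*)) /=.
under eq_bigr do rewrite prim_root_orthogonal//.
have [<-|nm] := eqVneq n m.
  under eq_bigr do rewrite eqxx muln1.
  by rewrite prodr_const card_ord muln1 natrX.
have [j nmj] : exists j, tnth n j != tnth m j.
  apply/existsP; apply: contraR nm; rewrite negb_exists => /forallP nm.
  by apply/eqP/eq_from_tnth => j; apply/eqP; have := nm j; rewrite negbK.
by rewrite (bigD1 j)//= (negbTE nmj) !muln0 mul0r.
Qed.

(** Expanding the square leaves only the diagonal terms. The grid separates exponents below M, so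
    the identity is exact. *)
Lemma root_parseval (s : seq (p.-tuple nat)) (c : p.-tuple nat -> C) :
  uniq s -> {in s, forall n j, tnth n j < M}%N ->
  \sum_k `|\sum_(n <- s) c n * root_monom k n| ^+ 2 =
  (M ^ p)%:R * \sum_(n <- s) `|c n| ^+ 2.
Proof.
move=> us sM.
under eq_bigr => k _ do
  (rewrite normCK rmorph_sum big_distrlr /=;
   under eq_bigr do under eq_bigr do rewrite rmorphM mulrACA).
rewrite exchange_big mulr_sumr /= [LHS]big_seq [RHS]big_seq.
apply: eq_bigr => n ns; rewrite exchange_big (bigD1_seq n)//=.
rewrite [X in _ + X]big_seq_cond [X in _ + X]big1 => [|m /andP[ms mn]].
  rewrite addr0 -mulr_sumr root_monom_orthogonal; try exact: sM.
  by rewrite eqxx muln1 normCK mulrC.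
rewrite -mulr_sumr root_monom_orthogonal; try exact: sM.
by rewrite eq_sym (negbTE mn) muln0 mulr0.
Qed.

End RootsOfUnity.

Section Parseval.
Context (R : realType).
Implicit Types (x y : R[i]).

Lemma normr_normc x : `|x| = (normc x)%:C%C. Proof. by []. Qed.

Lemma normc_ge0 x : 0 <= normc x.
Proof. by rewrite -(@ler0c R) -normr_normc. Qed.

(** By [root_parseval], the left-hand side is the mean over the grid of the right-hand side, and
    some grid point reaches the mean. *)
Lemma torus_parseval_ge p M (s : seq (p.-tuple nat)) (c : p.-tuple nat -> R[i]) :
  (0 < M)%N -> uniq s -> {in s, forall n j, tnth n j < M}%N ->
  exists2 u : 'I_p -> R[i], forall j, normc (u j) = 1 &
    \sum_(n <- s) normc (c n) ^+ 2 <=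
    normc (\sum_(n <- s) c n * \prod_(j < p) u j ^+ tnth n j) ^+ 2.
Proof.
move=> M0 us sM; have [w wp] := primitive_root_exists (R[i] : numClosedFieldType) M0.
apply: contrapT => noE.
have lt k : `|\sum_(n <- s) c n * root_monom w k n| ^+ 2 <
            \sum_(n <- s) `|c n| ^+ 2.
  have -> : \sum_(n <- s) `|c n| ^+ 2 =
            (\sum_(n <- s) normc (c n) ^+ 2)%:C%C.
    by rewrite rmorph_sum; apply: eq_bigr => n _; rewrite rmorphXn.
  rewrite normr_normc -rmorphXn ltcR ltNge; apply/negP => le; apply: noE.
  exists (fun j => w ^+ k j) => // j.
  have : `|w ^+ k j| = 1 by rewrite normrX (norm_prim_root wp) expr1n.
  by rewrite normr_normc => -[].
have := root_parseval wp c us sM; apply/eqP; rewrite lt_eqF//.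
have -> : (M ^ p)%:R * \sum_(n <- s) `|c n| ^+ 2 =
    \sum_(k : {ffun 'I_p -> 'I_M}) \sum_(n <- s) `|c n| ^+ 2.
  by rewrite sumr_const card_ffun !card_ord mulr_natl.
apply: ltr_sum => //.
by apply/hasP; exists [ffun=> Ordinal M0]; rewrite ?mem_index_enum.
Qed.

End Parseval.

(** * A lower bound for the maximum modulus *)

Lemma big_uniq_subset (V : nmodType) (I : eqType) (s1 s2 : seq I) (F : I -> V) :
  uniq s1 -> uniq s2 -> {subset s1 <= s2} ->
  \sum_(i <- s2) F i = \sum_(i <- s1) F i + \sum_(i <- s2 | i \notin s1) F i.
Proof.
move=> u1 u2 s12; rewrite (bigID (mem s1))/=; congr (_ + _).
rewrite -big_filter; apply: perm_big; apply: uniq_perm; rewrite ?filter_uniq//.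
by move=> i; rewrite mem_filter; case: (boolP (i \in s1)) => // /s12.
Qed.

(** * Finite families of multi-indices: boxes and degree truncations *)

Section DegreeSeq.
Context (p : nat).
Implicit Types (n : p.-tuple nat).

(** Listing through finite functions lets sums of products over the box factor by distributivity. *)
Definition box_seq N : seq (p.-tuple nat) :=
  codom (fun k : {ffun 'I_p -> 'I_N} => [tuple val (k j) | j < p]).

Lemma mem_box_seq N n : (forall j, tnth n j < N)%N -> n \in box_seq N.
Proof.
move=> nN; apply/codomP; exists [ffun j => Ordinal (nN j)].
by apply/eq_from_tnth => j; rewrite tnth_mktuple ffunE.
Qed.

Lemma box_seq_uniq N : uniq (box_seq N).
Proof.
rewrite map_inj_uniq ?enum_uniq// => k l kl.
apply/ffunP => j; apply/val_inj.
by have /(congr1 (fun n => tnth n j)) := kl; rewrite !tnth_mktuple.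
Qed.

Lemma sum_box_seq (K : comPzSemiRingType) N (g : 'I_p -> nat -> K) :
  \sum_(n <- box_seq N) \prod_j g j (tnth n j) = \prod_j \sum_(i < N) g j i.
Proof.
rewrite bigA_distr_bigA big_image /=; apply: eq_bigr => k _.
by apply: eq_bigr => j _; rewrite tnth_mktuple.
Qed.

(** The index set of the N-th partial sum in [powser]. *)
Definition degree_seq N : seq (p.-tuple nat) :=
  [seq n <- box_seq N | mdegree n < N]%N.

Lemma tnth_le_mdegree n j : (tnth n j <= mdegree n)%N.
Proof. by rewrite /mdegree (bigD1 j)//= leq_addr. Qed.

Lemma mem_degree_seq N n : (n \in degree_seq N) = (mdegree n < N)%N.
Proof.
rewrite mem_filter andbC; case: (boolP (mdegree n < N)%N); rewrite ?andbF// => nN.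
by rewrite andbT mem_box_seq// => j; exact: leq_ltn_trans (tnth_le_mdegree n j) nN.
Qed.

Lemma degree_seq_uniq N : uniq (degree_seq N).
Proof. by rewrite filter_uniq// box_seq_uniq. Qed.

Lemma degree_seq_set N : [set n | mdegree n < N]%N = [set` degree_seq N].
Proof. by apply/seteqP; split => n /=; rewrite mem_degree_seq. Qed.

Lemma degree_seq_subset N N' :
  (N <= N')%N -> {subset degree_seq N <= degree_seq N'}.
Proof. by move=> NN' n; rewrite !mem_degree_seq => /leq_trans; apply. Qed.

Lemma sub_degree_seq (s : seq (p.-tuple nat)) N :
  (\sum_(n <- s) mdegree n < N)%N -> {subset s <= degree_seq N}.
Proof.
move=> sN n ns; rewrite mem_degree_seq; apply: leq_ltn_trans sN.
by rewrite (big_rem n)//= leq_addr.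
Qed.

End DegreeSeq.

(** * Limits of complex sequences with a convergent majorant *)

Section ComplexLimit.
Context (R : realType).
Implicit Types (x y : R[i]).

Lemma normc_sum (I : Type) (s : seq I) (P : pred I) (F : I -> R[i]) :
  normc (\sum_(i <- s | P i) F i) <= \sum_(i <- s | P i) normc (F i).
Proof.
apply: (big_ind2 (fun x (a : R) => normc x <= a)) => //; first by rewrite normc0.
by move=> x a y b xa yb; rewrite (le_trans (le_normcD _ _))// lerD.
Qed.

Lemma normcB x y : normc (x - y) = normc (y - x).
Proof. by rewrite -normcN opprB. Qed.

Lemma Re_le_normc x : `|complex.Re x| <= normc x.
Proof. by have := normc_ge_Re x; rewrite normr_normc lecR. Qed.

Lemma Im_le_normc x : `|complex.Im x| <= normc x.
Proof.
have := Re_le_normc (x * 'i); case: x => a b /=.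
by rewrite !mulr0 !mulr1 sub0r addr0 normrN sqrrN addrC.
Qed.

Lemma normc_le_ReIm x : normc x <= `|complex.Re x| + `|complex.Im x|.
Proof.
case: x => a b /=.
rewrite -(ler_sqr (x := Num.sqrt _)) ?nnegrE ?sqrtr_ge0 ?addr_ge0//.
rewrite sqr_sqrtr ?addr_ge0 ?sqr_ge0// sqrrD !real_normK ?num_real//.
by rewrite lerD2r lerDl mulrn_wge0// mulr_ge0.
Qed.

(* [f + T] is nondecreasing and bounded. *)
Lemma cvgn_of_monotone_modulus (f T : R^nat) (B : R) : T @ \oo --> B ->
  (forall N N', (N <= N')%N -> `|f N' - f N| <= T N' - T N) -> cvgn f.
Proof.
move=> TB fT.
have ndT : nondecreasing_seq T.
  by move=> N N' NN'; rewrite -subr_ge0; apply: le_trans (fT _ _ NN').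
have T_le N : T N <= B.
  rewrite -(cvg_lim (@Rhausdorff R) TB); apply: nondecreasing_cvgn_le => //.
  by apply/cvg_ex; exists B.
have -> : f = (f \+ T) \- T by apply/funext => N /=; rewrite addrK.
apply: is_cvgB; last by apply/cvg_ex; exists B.
apply: nondecreasing_is_cvgn.
  move=> N N' NN' /=; have := fT _ _ NN'; rewrite ler_norml => /andP[+ _]; lra.
exists (f 0%N + 2 * B - T 0%N) => _ [N _ <-] /=.
have := fT 0%N N (leq0n N); rewrite ler_norml => /andP[_].
by have := T_le N; lra.
Qed.

(** Real and imaginary parts converge separately by [cvgn_of_monotone_modulus]; letting N' tend to
    infinity in the hypothesis then bounds the distance to the limit by the tail of T. *)
Lemma limn_complex_dist (S : nat -> R[i]) (T : R^nat) (B : R) : T @ \oo --> B ->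
  (forall N N', (N <= N')%N -> normc (S N' - S N) <= T N' - T N) ->
  forall N, normc (limn (S : nat -> R[i]^o) - S N) <= B - T N.
Proof.
move=> TB ST.
have ndT : nondecreasing_seq T.
  by move=> N N' NN'; rewrite -subr_ge0; apply: le_trans (ST _ _ NN'); exact: normc_ge0.
have T_le N : T N <= B.
  rewrite -(cvg_lim (@Rhausdorff R) TB); apply: nondecreasing_cvgn_le => //.
  by apply/cvg_ex; exists B.
have cRe : cvgn (fun N => complex.Re (S N)).
  apply: (cvgn_of_monotone_modulus TB) => N N' /ST; apply: le_trans.
  by rewrite -raddfB; exact: Re_le_normc.
have cIm : cvgn (fun N => complex.Im (S N)).
  apply: (cvgn_of_monotone_modulus TB) => N N' /ST; apply: le_trans.
  by rewrite -raddfB; exact: Im_le_normc.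
pose l : R[i] := (limn (fun N => complex.Re (S N)) +i*
                  limn (fun N => complex.Im (S N)))%C.
have Sl e : 0 < e -> \forall N \near \oo, normc (l - S N) < e.
  move=> e0; have e20 : 0 < e / 2 by rewrite divr_gt0.
  have /cvgrPdist_lt/(_ _ e20) hRe :
    (fun N => complex.Re (S N)) @ \oo --> complex.Re l by [].
  have /cvgrPdist_lt/(_ _ e20) hIm :
    (fun N => complex.Im (S N)) @ \oo --> complex.Im l by [].
  near=> N; apply: le_lt_trans (normc_le_ReIm _) _.
  rewrite !raddfB [e]splitr; apply: ltrD.
    by near: N.
  by near: N.
have -> : limn (S : nat -> R[i]^o) = l.
  apply: cvg_lim; first exact: norm_hausdorff.
  apply/cvgrPdist_lt => e e0.
  (* The radius e is itself a complex number here, and its positivity forces it to be real. *)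
  have eE : e = (complex.Re e)%:C%C.
    by case: e e0 => a b; rewrite ltcE /= => /andP[/eqP -> _].
  have {}e0 : 0 < complex.Re e by move: e0; rewrite eE ltcR.
  near=> N; rewrite eE normr_normc ltcR; near: N; exact: Sl.
move=> N; apply/ler_addgt0Pr => e /Sl[N1 _ hN1].
have NM := leq_maxl N N1; have N1M := leq_maxr N N1.
move: (maxn N N1) NM N1M => M NM N1M.
rewrite -(subrKA (S M)); apply: (le_trans (le_normcD _ _)); rewrite addrC; apply: lerD.
  by apply: (le_trans (ST _ _ NM)); rewrite lerD2r.
exact/ltW/hN1.
Unshelve. all: by end_near. Qed.

End ComplexLimit.

(** * Parseval bound for the maximum modulus of a power series *)

Section PowserLowerBound.
Context (R : realType) (p : nat).
Implicit Types (n : p.-tuple nat) (r : p.-tuple R) (b : p.-tuple nat -> R[i]).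

Lemma normc_prod (I : Type) (s : seq I) (F : I -> R[i]) :
  normc (\prod_(i <- s) F i) = \prod_(i <- s) normc (F i).
Proof. exact: (big_morph _ (@normcM R) (@normc1 R)). Qed.

Lemma normcX (x : R[i]) k : normc (x ^+ k) = normc x ^+ k.
Proof. by elim: k => [|k IH]; rewrite ?normc1// !exprS normcM IH. Qed.

Lemma normc_real (a : R) : normc a%:C%C = `|a|.
Proof. by rewrite /= expr0n /= addr0 sqrtr_sqr. Qed.

Lemma normc_zmonom (z : 'rV[R[i]^o]_p) n :
  normc (zmonom z n) = \prod_(j < p) normc (z ord0 j) ^+ tnth n j.
Proof. by rewrite normc_prod; apply: eq_bigr => j _; rewrite normcX. Qed.

Lemma rmonom_ge0 r n : (forall j, 0 <= tnth r j) -> 0 <= rmonom r n.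
Proof. by move=> r0; apply: prodr_ge0 => j _; rewrite exprn_ge0. Qed.

(** Parseval applies to a long partial sum, which differs from the series by at most B - T N
    everywhere on the torus |z_j| = r_j. Without absolute convergence the bound is trivial,
    [max_modulus] being infinite. *)
Lemma max_modulus_ge b r (W : seq (p.-tuple nat)) :
  (forall j, 0 <= tnth r j) -> uniq W ->
  ((Num.sqrt (\sum_(n <- W) (normc (b n) * rmonom r n) ^+ 2))%:E <= max_modulus b r)%E.
Proof.
move=> r0 uW; rewrite /max_modulus; case: asboolP => [conv|]; last by rewrite leey.
pose t n := normc (b n) * rmonom r n.
have t0 n : 0 <= t n by rewrite mulr_ge0 ?normc_ge0 ?rmonom_ge0.
have tE (z : 'rV[R[i]^o]_p) n :
    (forall j, normc (z ord0 j) = tnth r j) -> normc (b n * zmonom z n) = t n.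
  move=> zr; rewrite normcM normc_zmonom; congr (_ * _).
  by apply: eq_bigr => j _; rewrite zr.
pose T N := \sum_(n <- degree_seq p N) t n.
have T_bound : exists B, forall N, T N <= B.
  (* Absolute convergence at the single point r bounds the majorant for the whole torus. *)
  pose z : 'rV[R[i]^o]_p := \row_j (tnth r j)%:C%C.
  have zr j : normc (z ord0 j) = tnth r j by rewrite mxE normc_real ger0_norm.
  have /conv : closed_polydisc r z by move=> j; rewrite zr.
  rewrite /absolutely_convergent; set s := esum _ _ => s_fin.
  have s_ge N : ((T N)%:E <= s)%E.
    apply: esum_ge; exists [set` degree_seq p N].
      by split => //; exact: finite_seq.
    rewrite -fsbig_seq ?degree_seq_uniq// sumEFin lee_fin /T.
    by under [leRHS]eq_bigr do rewrite tE//.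
  have s_fn : s \is a fin_num.
    by rewrite ge0_fin_numE// (le_trans _ (s_ge 0%N))// lee_fin sumr_ge0.
  by exists (fine s) => N; rewrite -lee_fin fineK.
have [B TB] : exists B : R, T @ \oo --> B.
  exists (limn T); apply: (@nondecreasing_is_cvgn _ T).
    move=> N N' NN'; rewrite /T.
    rewrite (big_uniq_subset _ _ _ (degree_seq_subset NN')) ?degree_seq_uniq//.
    by rewrite lerDl sumr_ge0.
  by have [B TB] := T_bound; exists B => _ [N _ <-].
apply/lee_addgt0Pr => e e0.
have [N0 _ N0e] : \forall N \near \oo, B - T N < e.
  move/cvgrPdist_lt : TB => /(_ _ e0); apply: filterS => N.
  by rewrite ltr_norml => /andP[_].
(* N makes the tail smaller than e and the partial sum contain W. It is also the order of the root
   of unity, hence must be positive and exceed all exponents. *)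
pose N := maxn N0 (\sum_(n <- W) mdegree n).+1.
have {N0e} Ne : B - T N < e by apply: N0e; exact: leq_maxl.
have WN : {subset W <= degree_seq p N}.
  by apply: sub_degree_seq; rewrite leq_max ltnSn orbT.
have N_gt0 : (0 < N)%N by rewrite /N leq_max orbT.
have NN : {in degree_seq p N, forall n j, tnth n j < N}%N.
  by move=> n; rewrite mem_degree_seq => nN j;
    exact: leq_ltn_trans (tnth_le_mdegree n j) nN.
(* The point u depends on N, which is harmless because the tail bound is uniform on the torus. *)
have [u u1 uP] := torus_parseval_ge (fun n => b n * (rmonom r n)%:C%C)
  N_gt0 (degree_seq_uniq p N) NN.
pose z : 'rV[R[i]^o]_p := \row_j ((tnth r j)%:C%C * u j).
have zr j : normc (z ord0 j) = tnth r j.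
  by rewrite mxE normcM u1 mulr1 normc_real ger0_norm.
have zE n : b n * zmonom z n = b n * (rmonom r n)%:C%C * \prod_(j < p) u j ^+ tnth n j.
  rewrite -mulrA; congr (_ * _); rewrite /zmonom rmorph_prod -big_split /=.
  by apply: eq_bigr => j _; rewrite mxE exprMn rmorphXn.
pose S N := \sum_(n <- degree_seq p N) b n * zmonom z n.
have fE : powser b z = limn (S : nat -> R[i]^o).
  apply: (congr1 (fun g : nat -> R[i]^o => limn g)); apply/funext => N'.
  by rewrite degree_seq_set -fsbig_seq ?degree_seq_uniq.
have ST N1 N2 : (N1 <= N2)%N -> normc (S N2 - S N1) <= T N2 - T N1.
  move=> N12; rewrite /S /T.
  rewrite !(big_uniq_subset _ _ _ (degree_seq_subset N12)) ?degree_seq_uniq//.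
  rewrite [_ + _ - _]addrAC subrr add0r [leRHS]addrAC subrr add0r.
  apply: le_trans (normc_sum _ _ _) _.
  by apply: ler_sum => n _; rewrite tE.
have := limn_complex_dist TB ST N; rewrite -fE => fS.
apply: (@le_trans _ _ (normc (powser b z) + e)%:E); last first.
  rewrite EFinD leeD2r//; apply: ereal_sup_ubound; exists z => //.
  by move=> j; rewrite zr.
rewrite lee_fin; apply: (@le_trans _ _ (normc (S N))).
  have nS : 0 <= normc (S N) by exact: normc_ge0.
  rewrite -(ger0_norm nS) -sqrtr_sqr; apply: ler_wsqrtr.
  rewrite /S; under [in leRHS]eq_bigr do rewrite zE.
  apply: le_trans uP.
  rewrite (big_uniq_subset _ _ _ WN) ?degree_seq_uniq//.
  under eq_bigr do rewrite -[rmonom r _]ger0_norm ?rmonom_ge0// -normc_real -normcM.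
  by rewrite lerDl sumr_ge0// => n _; rewrite exprn_ge0// normc_ge0.
by have := le_normcD (powser b z) (S N - powser b z); rewrite addrC subrK normcB; lra.
Qed.

End PowserLowerBound.

(** * The coefficients exp (2 sqrt n) *)

Section SqrtCoef.
Context (R : realType).
Implicit Types (x y s : R).

Definition sqrt_coef n : R := expR (2 * Num.sqrt n%:R).

Lemma sqrt_coefM n x : 0 < x ->
  sqrt_coef n * x ^+ n = expR (2 * Num.sqrt n%:R - n%:R * - ln x).
Proof.
move=> x0; rewrite mulrN opprK expRD; congr (_ * _).
by rewrite mulrC expRM_natr lnK.
Qed.

(** Completing the square in w = sqrt n, with s = - ln x: 1/s exceeds the exponent by (w s - 1)^2 /
    s. *)
Lemma sqrt_coef_le n x : 0 < x < 1 -> sqrt_coef n * x ^+ n <= expR (- ln x)^-1.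
Proof.
move=> /andP[x0 x1]; rewrite sqrt_coefM// ler_expR.
have s0 : 0 < - ln x by rewrite oppr_gt0 ln_lt0// x0.
move: (- ln x) s0 => s s0.
have [w w0 ->] : exists2 w : R, 0 <= w & n%:R = w ^+ 2.
  by exists (Num.sqrt n%:R); rewrite ?sqrtr_ge0// sqr_sqrtr.
rewrite sqrtr_sqr ger0_norm// -subr_ge0.
have -> : s^-1 - (2 * w - w ^+ 2 * s) = (w * s - 1) ^+ 2 * s^-1.
  by field; rewrite gt_eqF.
by rewrite mulr_ge0 ?sqr_ge0// invr_ge0 ltW.
Qed.

(** At the midpoint x' of x and 1 the terms are bounded by [sqrt_coef_le], so at x they are
    dominated by a geometric series of ratio x / x' < 1. *)
Lemma sqrt_coef_sum_bounded x : 0 <= x < 1 ->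
  exists B, forall N, \sum_(i < N) sqrt_coef i * x ^+ i <= B.
Proof.
move=> /andP[x0 x1]; pose x' := (1 + x) / 2; pose c := x / x'.
have x'0 : 0 < x' by rewrite /x'; lra.
have x'1 : x' < 1 by rewrite /x'; lra.
have c0 : 0 <= c by rewrite divr_ge0 // ltW.
have c1 : c < 1 by rewrite ltr_pdivrMr// mul1r /x'; lra.
exists (expR (- ln x')^-1 * (1 - c)^-1) => N.
apply: (@le_trans _ _ (\sum_(i < N) expR (- ln x')^-1 * c ^+ i)).
  apply: ler_sum => i _.
  have -> : x = x' * c by rewrite mulrC divfK ?gt_eqF.
  rewrite exprMn mulrA ler_wpM2r ?exprn_ge0// sqrt_coef_le// x'0//.
rewrite -mulr_sumr ler_wpM2l ?expR_ge0//.
have c1' : 0 < 1 - c by rewrite subr_gt0.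
rewrite -[leRHS]div1r ler_pdivlMr// mulrC -opprB mulNr -subrX1 opprB.
by rewrite lerBlDr lerDl exprn_ge0.
Qed.

(* Near its maximum over n, the exponent [2 sqrt n - n / y^2] equals
   [y^2 - (sqrt n - y^2)^2 / y^2], so it exceeds [y^2 - 1] on about [y^3]
   consecutive integers. *)
Lemma sqrt_coef_window y : 1 <= y -> exists N0, forall N, (N0 <= N)%N ->
  expR (y ^+ 2 - 1) ^+ 2 * y ^+ 3 <=
  \sum_(i < N) (sqrt_coef i * expR (- y ^- 2) ^+ i) ^+ 2.
Proof.
move=> y1; have y0 : 0 < y by lra.
(* The window m <= i < m + k starts just above the peak i = y^4 and has more than y^3 elements. On
   it y^2 <= sqrt i <= y^2 + y, since y^4 + y^3 + 1 <= (y^2 + y)^2 for y >= 1. *)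
pose m := (Num.truncn (y ^+ 4)).+1; pose k := (Num.truncn (y ^+ 3)).+1.
have := truncn_itv (exprn_ge0 4 (ltW y0)); rewrite -/m -natr1 => /andP[m2 m1].
have := truncn_itv (exprn_ge0 3 (ltW y0)); rewrite -/k -natr1 => /andP[k2 k1].
exists (m + k)%N => N mkN.
rewrite -(big_mkord predT (fun i => (sqrt_coef i * expR (- y ^- 2) ^+ i) ^+ 2)).
rewrite (big_cat_nat (leq0n m) (leq_trans (leq_addr k m) mkN))/=.
rewrite (big_cat_nat (leq_addr k m) mkN)/=.
apply: ler_wpDl; first by apply: sumr_ge0 => i _; exact: sqr_ge0.
apply: ler_wpDr; first by apply: sumr_ge0 => i _; exact: sqr_ge0.
apply: (@le_trans _ _ (\sum_(m <= i < m + k) expR (y ^+ 2 - 1) ^+ 2)).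
  rewrite sumr_const_nat addKn -[leRHS]mulr_natr ler_wpM2l ?sqr_ge0//.
  by rewrite -natr1 ltW.
apply: ler_sum_nat => i /andP[mi imk].
rewrite ler_sqr ?nnegrE ?expR_ge0//; last by rewrite mulr_ge0 ?exprn_ge0 ?expR_ge0.
rewrite sqrt_coefM ?expR_gt0// expRK ler_expR opprK.
have i1 : y ^+ 4 <= i%:R.
  by rewrite (le_trans (ltW m1))// natr1 ler_nat.
have i2 : i%:R <= y ^+ 4 + y ^+ 3 + 1.
  have : i.+1%:R <= m%:R + k%:R :> R by rewrite -natrD ler_nat.
  by rewrite -!natr1 in m1 m2 k1 k2 *; lra.
have [w w0 iE] : exists2 w : R, 0 <= w & i%:R = w ^+ 2.
  by exists (Num.sqrt i%:R); rewrite ?sqrtr_ge0// sqr_sqrtr.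
rewrite iE in i1 i2 *; rewrite sqrtr_sqr ger0_norm//.
have w1 : y ^+ 2 <= w.
  by rewrite -ler_sqr ?nnegrE ?sqr_ge0// -exprM.
have w2 : w <= y ^+ 2 + y.
  rewrite -ler_sqr ?nnegrE ?addr_ge0 ?sqr_ge0 ?(ltW y0)//; nra.
rewrite -subr_ge0.
have -> : 2 * w - w ^+ 2 * y ^- 2 - (y ^+ 2 - 1) =
    (y ^+ 2 - (w - y ^+ 2) ^+ 2) / y ^+ 2.
  by field; rewrite gt_eqF.
rewrite divr_ge0 ?sqr_ge0// subr_ge0 ler_sqr ?nnegrE ?subr_ge0 ?(ltW y0)//; lra.
Qed.

(** Both bounds are ln u <= u - 1, at u = x and u = 1/x; x >= 1/2 turns (1 - x) / x into 2 (1 -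
    x). *)
Lemma oppr_ln_itv x : 2^-1 <= x < 1 -> 1 - x <= - ln x <= 2 * (1 - x).
Proof.
move=> /andP[x2 x1]; have x0 : 0 < x by lra.
have h1 : ln x <= x - 1.
  by have := @le_ln1Dx R (x - 1); rewrite subrKC; apply; lra.
have h2 : ln x^-1 <= x^-1 - 1.
  have := @le_ln1Dx R (x^-1 - 1); rewrite subrKC; apply.
  by rewrite ltrBrDl subrr invr_gt0.
rewrite lnV ?posrE// in h2.
apply/andP; split; first lra.
apply: (le_trans h2); rewrite -(ler_pM2r x0) mulrBl mulVf ?gt_eqF//; nra.
Qed.

(** [sqrt_coef_window] at y = s^(-1/2), s = - ln x. The nested root is q = (1 - x)^(-1/4), and the
    y^3 window terms contribute a multiple of q^6 to the sum of squares. *)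
Lemma sqrt_coef_l2_ge x : 2^-1 <= x < 1 -> exists N0, forall N, (N0 <= N)%N ->
  (expR (-1) / 3 * (expR (- ln x)^-1 * Num.sqrt (Num.sqrt (1 - x)^-1) ^+ 3)) ^+ 2
  <= \sum_(i < N) (sqrt_coef i * x ^+ i) ^+ 2.
Proof.
move=> xI; have /andP[s1 s2] := oppr_ln_itv xI; have /andP[x2 x1] := xI.
have x0 : 0 < x by lra.
have lnxE : x = expR (- - ln x) by rewrite opprK lnK.
move: (- ln x) s1 s2 lnxE => s s1 s2 xE.
have d0 : 0 < 1 - x by lra.
have s0 : 0 < s by lra.
pose y := Num.sqrt s^-1; pose q := Num.sqrt (Num.sqrt (1 - x)^-1).
have y2 : y ^+ 2 = s^-1 by rewrite sqr_sqrtr// invr_ge0 ltW.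
have q0 : 0 <= q by exact: sqrtr_ge0.
have q4 : q ^+ 4 = (1 - x)^-1.
  by rewrite (exprM _ 2 2) sqr_sqrtr ?sqrtr_ge0// sqr_sqrtr// invr_ge0 ltW.
have y0 : 0 <= y by exact: sqrtr_ge0.
have y1 : 1 <= y.
  by rewrite -ler_sqr ?nnegrE// y2 expr1n -[1]invr1 lef_pV2 ?posrE//; lra.
have yq : q ^+ 4 <= 2 * y ^+ 2.
  rewrite q4 y2 -ler_pdivrMl// -invfM lef_pV2 ?posrE ?mulr_gt0//.
have [N0 N0P] := sqrt_coef_window y1; exists N0 => N /N0P.
rewrite y2 invrK -xE; apply: le_trans.
rewrite -/q -y2 expRD.
have q2 : q ^+ 2 <= 2 * y.
  rewrite -ler_sqr ?nnegrE ?sqr_ge0 ?mulr_ge0// -exprM exprMn; nra.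
(* The constant (2 y)^3 = 8 y^3 is rounded up to the square 9, whence the factor 1/3 in the
   statement. *)
have q6 : (q ^+ 3) ^+ 2 <= 9 * y ^+ 3.
  rewrite -exprM (exprM _ 2 3); apply: (@le_trans _ _ ((2 * y) ^+ 3)).
    by rewrite lerXn2r ?nnegrE ?sqr_ge0 ?mulr_ge0.
  by rewrite exprMn ler_wpM2r ?exprn_ge0//; lra.
rewrite [leLHS](_ : _ =
  (expR (y ^+ 2) * expR (-1)) ^+ 2 * ((q ^+ 3) ^+ 2 / 9)); last by field.
by rewrite ler_wpM2l ?sqr_ge0// ler_pdivrMr// mulrC.
Qed.

End SqrtCoef.

(** * The function f: domain of convergence and maximal term *)

Section ProductCoef.
Context (R : realType) (p : nat).
Implicit Types (n : p.-tuple nat) (r : p.-tuple R).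

Definition prod_coef n : R[i] := (\prod_(j < p) sqrt_coef R (tnth n j))%:C%C.

Lemma normc_prod_coef n : normc (prod_coef n) = \prod_(j < p) sqrt_coef R (tnth n j).
Proof. by rewrite normc_real ger0_norm// prodr_ge0// => j _; exact: expR_ge0. Qed.

Lemma normc_prod_coef_zmonom n (z : 'rV[R[i]^o]_p) :
  normc (prod_coef n * zmonom z n) =
  \prod_(j < p) (sqrt_coef R (tnth n j) * normc (z ord0 j) ^+ tnth n j).
Proof. by rewrite normcM normc_prod_coef normc_zmonom big_split. Qed.

(** Every finite set of multi-indices lies in a box, and the terms are nonnegative. *)
Lemma esum_box_le (f : p.-tuple nat -> R) (B : R) : (forall n, 0 <= f n) ->
  (forall N, \sum_(n <- box_seq p N) f n <= B) ->
  (\esum_(n in [set: p.-tuple nat]) (f n)%:E <= B%:E)%E.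
Proof.
move=> f0 fB; apply: ge_ereal_sup => _ [X [finX _] <-].
rewrite fsbig_finite//= sumEFin lee_fin.
have : uniq (finmap.enum_fset (fset_set X)) by exact: finmap.fset_uniq.
move: (finmap.enum_fset _) => s us.
apply: le_trans (fB (\sum_(n <- s) mdegree n).+1).
have sub : {subset s <= box_seq p (\sum_(n <- s) mdegree n).+1}.
  move=> n ns; apply: mem_box_seq => j; rewrite ltnS.
  by rewrite (leq_trans (tnth_le_mdegree n j))// (big_rem n)//= leq_addr.
by rewrite (big_uniq_subset _ _ _ sub) ?box_seq_uniq// lerDl sumr_ge0.
Qed.

(** Over a box the sum factors into one-variable sums, each bounded by [sqrt_coef_sum_bounded]. *)
Lemma prod_coef_convergent (z : 'rV[R[i]^o]_p) :
  polydisc z -> absolutely_convergent prod_coef z.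
Proof.
move=> zD.
have /choice[B BP] : forall j : 'I_p, exists B, forall N,
    \sum_(i < N) sqrt_coef R i * normc (z ord0 j) ^+ i <= B.
  by move=> j; apply: sqrt_coef_sum_bounded; rewrite normc_ge0 zD.
apply: le_lt_trans (ltry (\prod_j B j)).
apply: esum_box_le => [n|N]; first exact: normc_ge0.
rewrite (eq_bigr _ (fun n _ => normc_prod_coef_zmonom n z)).
rewrite (sum_box_seq N (fun j i => sqrt_coef R i * normc (z ord0 j) ^+ i)).
apply: ler_prod => j _; rewrite BP andbT sumr_ge0// => i _.
by rewrite mulr_ge0 ?expR_ge0// exprn_ge0// normc_ge0.
Qed.

(** If |z_j| >= 1, the infinitely many terms with indices on the j-th axis all have modulus at least
    1, the coefficients being at least 1. *)
Lemma prod_coef_divergent (z : 'rV[R[i]^o]_p) :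
  absolutely_convergent prod_coef z -> polydisc z.
Proof.
move=> conv j; rewrite ltNge; apply/negP => zj.
pose e k : p.-tuple nat := [tuple if i == j then k else 0%N | i < p].
have e_inj : injective e.
  by move=> k l /(congr1 (fun n => tnth n j)); rewrite !tnth_mktuple eqxx.
have term_ge1 k : 1 <= normc (prod_coef (e k) * zmonom z (e k)).
  rewrite normc_prod_coef_zmonom.
  apply: (big_ind (fun x : R => 1 <= x)) => // [|i _]; first exact: mulr_ege1.
  rewrite tnth_mktuple; apply: mulr_ege1.
    by rewrite -expR0 ler_expR mulr_ge0 ?sqrtr_ge0.
  by case: eqVneq => [->|_]; rewrite ?expr0// exprn_ege1.
have esum_ge N : (N%:R%:E <= \esum_(n in [set: p.-tuple nat])
    (normc (prod_coef n * zmonom z n))%:E)%E.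
  apply: esum_ge; exists [set` map e (iota 0 N)].
    by split => //; exact: finite_seq.
  rewrite -fsbig_seq ?map_inj_uniq ?iota_uniq// big_map sumEFin lee_fin.
  rewrite -[X in X%:R](size_iota 0 N) -sum1_size natr_sum.
  by apply: ler_sum => k _.
move: conv; rewrite /absolutely_convergent; move: (esum _ _) esum_ge => [s|//|] h.
  have := h (Num.truncn s).+1; rewrite lee_fin leNgt => /negP[].
  exact: truncnS_gt.
by have := h 0%N.
Qed.

Lemma polydisc_open : open (@polydisc R p).
Proof.
rewrite openE => z zD.
apply: (@filter_forall _ 'I_p
  (fun j (z' : 'rV[R[i]^o]_p) => normc (z' ord0 j) < 1) (nbhs z)) => j.
have zj := zD j.
have e0 : 0 < (1 - normc (z ord0 j))%:C%C :> R[i] by rewrite ltcR subr_gt0.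
have /cvgrPdist_lt/(_ _ e0) := @coord_continuous R[i] 1 p ord0 j z.
apply: filterS => z'; rewrite normr_normc ltcR => d.
have := le_normcD (z ord0 j) (z' ord0 j - z ord0 j).
by rewrite subrKC normcB; lra.
Qed.

Lemma prod_coef_classA : classA prod_coef.
Proof.
rewrite /classA (_ : absolutely_convergent _ = @polydisc R p).
  exact/interior_id/polydisc_open.
apply/seteqP; split => z; [exact: prod_coef_divergent|exact: prod_coef_convergent].
Qed.

Lemma prod_coef_rmonom n r : normc (prod_coef n) * rmonom r n =
  \prod_(j < p) (sqrt_coef R (tnth n j) * tnth r j ^+ tnth n j).
Proof. by rewrite normc_prod_coef -big_split. Qed.

(** The term of index 0 equals 1, and [sqrt_coef_le] bounds every term factor by factor. This bound
    also ensures that the real supremum is a genuine one. *)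
Lemma max_term_prod_coef r : (forall j, 0 < tnth r j < 1) ->
  1 <= max_term prod_coef r <= \prod_(j < p) expR (- ln (tnth r j))^-1.
Proof.
move=> rI.
pose n0 : p.-tuple nat := [tuple 0%N | j < p].
have bound n : normc (prod_coef n) * rmonom r n <=
    \prod_(j < p) expR (- ln (tnth r j))^-1.
  rewrite prod_coef_rmonom; apply: ler_prod => j _.
  rewrite sqrt_coef_le// andbT mulr_ge0 ?expR_ge0// exprn_ge0//.
  by have /andP[/ltW] := rI j.
apply/andP; split; last first.
  apply: ge_sup; first by exists (normc (prod_coef n0) * rmonom r n0), n0.
  by move=> _ [n _ <-].
apply: (@le_trans _ _ (normc (prod_coef n0) * rmonom r n0)).
  rewrite prod_coef_rmonom big1// => j _.
  by rewrite tnth_mktuple expr0 /sqrt_coef sqrtr0 mulr0 expR0 mulr1.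
apply: ub_le_sup; last by exists n0.
by exists (\prod_(j < p) expR (- ln (tnth r j))^-1) => _ [n _ <-].
Qed.

End ProductCoef.

(** * Logarithmic measure of dyadic boxes *)

Section DyadicBoxes.
Context (R : realType).

Lemma measurable_tuple_box p (A : 'I_p -> set R) : (forall j, measurable (A j)) ->
  measurable [set r : p.-tuple R | forall j, A j (tnth r j)].
Proof.
move=> mA.
have -> : [set r : p.-tuple R | forall j, A j (tnth r j)] =
    \bigcap_(j in [set: 'I_p]) ((fun r : p.-tuple R => tnth r j) @^-1` A j).
  by apply/seteqP; split => r h j; [move=> _; exact: h | exact: (h j I)].
apply: fin_bigcap_measurable => // j _; rewrite -[X in measurable X]setTI.
exact: measurable_tnth.
Qed.

(** Induction along [lebesgue_tuple]: the preimage of a box under [pcons] is A times a box of one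
    dimension less, and in dimension 0 the Dirac mass gives 1. *)
Lemma lebesgue_tuple_box p (A : set R) (a : R) : measurable A ->
  lebesgue_measure A = a%:E ->
  lebesgue_tuple p [set r : p.-tuple R | forall j, A (tnth r j)] = (a ^+ p)%:E.
Proof.
move=> mA Aa; elim: p => [|p IH].
  rewrite [LHS]/= diracE mem_set// => -[]//.
transitivity ((lebesgue_measure \x (lebesgue_tuple p))%E
    (A `*` [set r : p.-tuple R | forall j, A (tnth r j)])).
  rewrite /= /lebesgue_cons /pushforward; congr (_ _).
  apply/seteqP; split => -[x r] /= h.
    split; first exact: (h ord0).
    by move=> j; have := h (lift ord0 j); rewrite tnthS.
  case: h => Ax Ar j; case: (unliftP ord0 j) => [i|] ->; last by [].
  by rewrite tnthS.
rewrite product_measure1E//; last exact: measurable_tuple_box (fun=> mA).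
by rewrite exprS EFinM; congr (_ * _)%E.
Qed.

Context (p : nat).

Definition dyadic_itv k : set R := `[1 - 2 ^- k, 1 - 2 ^- k.+1[%classic.

Definition dyadic_box k : set (p.-tuple R) :=
  [set r | forall j, dyadic_itv k (tnth r j)].

(** Box 0 is left out so that all coordinates are at least 1/2, as [oppr_ln_itv] requires. *)
Definition dyadic_corner : set (p.-tuple R) := \bigcup_k dyadic_box k.+1.

Lemma dyadic_itvE k x : dyadic_itv k x -> 2 ^- k.+1 < 1 - x <= 2 ^- k.
Proof. by rewrite /dyadic_itv /= in_itv /= => /andP[? ?]; apply/andP; split; lra. Qed.

Lemma half_pow k : 2 ^- k = 2 * 2 ^- k.+1 :> R.
Proof. by rewrite exprS invfM mulrA divff ?mul1r// pnatr_eq0. Qed.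

Lemma measurable_dyadic_box k : measurable (dyadic_box k).
Proof.
by apply: (@measurable_tuple_box p (fun=> dyadic_itv k)) => j; exact: measurable_itv.
Qed.

Lemma measurable_dyadic_corner : measurable dyadic_corner.
Proof. by apply: bigcup_measurable => k _; exact: measurable_dyadic_box. Qed.

Lemma dyadic_corner_lebesgue_measurable : lebesgue_measurable dyadic_corner.
Proof. exact: caratheodory_measurable_mu_ext measurable_dyadic_corner. Qed.

Lemma dyadic_box_sub_cube k : dyadic_box k `<=` unit_cube.
Proof.
move=> r rk j; have /dyadic_itvE/andP[h1 h2] := rk j.
have h3 : 0 < 2 ^- k.+1 :> R by rewrite invr_gt0 exprn_gt0.
have h4 : 2 ^- k <= 1 :> R by rewrite invf_le1 ?exprn_gt0// exprn_ege1// ler1n.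
by apply/andP; split; lra.
Qed.

Lemma dyadic_corner_sub_cube : dyadic_corner `<=` unit_cube.
Proof. by move=> r [k _ /dyadic_box_sub_cube]. Qed.

Lemma measure_dyadic_box k : lebesgue_tuple p (dyadic_box k) = ((2 ^- k.+1) ^+ p)%:E.
Proof.
apply: lebesgue_tuple_box; first exact: measurable_itv.
rewrite lebesgue_measure_itv /= lte_fin half_pow.
have h3 : 0 < 2 ^- k.+1 :> R by rewrite invr_gt0 exprn_gt0.
by rewrite ifT -?EFinB; [congr EFin|]; lra.
Qed.

(** A single coordinate separates two boxes, hence the positive dimension. *)
Lemma trivIset_dyadic_box (K : nat) : (0 < p)%N ->
  trivIset setT (fun k => dyadic_box (K + k)).
Proof.
move=> p0; have lt_disj k l r : (k < l)%N -> dyadic_box k r -> dyadic_box l r -> False.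
  move=> kl /(_ (Ordinal p0))/dyadic_itvE/andP[h1 _].
  move=> /(_ (Ordinal p0))/dyadic_itvE/andP[_ h2].
  have : 2 ^- l <= 2 ^- k.+1 :> R.
    by rewrite lef_pV2 ?posrE ?exprn_gt0// ler_eXn2l// ltr1n.
  by lra.
move=> k l _ _ [r [rk rl]]; case: (ltngtP k l) => // kl.
  by case: (lt_disj _ _ _ _ rk rl); rewrite ltn_add2l.
by case: (lt_disj _ _ _ _ rl rk); rewrite ltn_add2l.
Qed.

Local Notation density :=
  ((fun r => (\prod_(i < p) (1 - tnth r i)^-1)%:E) : p.-tuple R -> \bar R).

Lemma measurable_density (D : set (p.-tuple R)) :
  D `<=` unit_cube -> measurable D ->
  measurable_fun D density.
Proof.
move=> Dc mD; apply/measurable_EFinP.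
(* On the cube the inverse agrees with the power -1, measurable on the whole line. *)
apply: (eq_measurable_fun (fun r : p.-tuple R => \prod_(i < p) (1 - tnth r i) `^ (-1))).
  move=> r /set_mem/Dc rc; apply: eq_bigr => i _.
  by rewrite powR_inv1//; have := rc i; lra.
apply: measurable_prod => i _.
apply: (measurableT_comp (measurable_powR (-1))).
apply: measurable_funB; first exact: measurable_cst.
exact: measurable_funTS (measurable_tnth i).
Qed.

Lemma measurable_triangle (r0 : p.-tuple R) : measurable (triangle r0).
Proof.
pose A j : set R := `[0, 1[%classic `&` `[tnth r0 j, +oo[%classic.
have -> : triangle r0 = [set t : p.-tuple R | forall j, A j (tnth t j)].
  apply/seteqP; split => t /=.
    by move=> [t01 tr0] j; rewrite /A /= !in_itv /= t01 tr0.
  by move=> h; split=> j; have := h j; rewrite /A /= !in_itv /= andbT; tauto.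
apply: measurable_tuple_box => j.
by apply: measurableI; exact: measurable_itv.
Qed.

Lemma measurable_density_cara (D : set (p.-tuple R)) : D `<=` unit_cube ->
  measurable D ->
  @measurable_fun _ _ (caratheodory_type ((lebesgue_tuple p)^*)%mu) (\bar R) D density.
Proof.
move=> Dc mD _ Y mY; apply: caratheodory_measurable_mu_ext.
exact: (measurable_density Dc mD mD mY).
Qed.

(** The density is at least 2^(k p) on a box of volume 2^(-(k+1) p), so the bound does not depend on
    k. *)
Lemma log_measure_dyadic_box_ge k :
  ((2 ^- p)%:E <= log_measure (dyadic_box k))%E.
Proof.
have mB := caratheodory_measurable_mu_ext (lebesgue_tuple p) (@measurable_dyadic_box k).
apply: (@le_trans _ _ (\int[completed_lebesgue_tuple R p]_(r in dyadic_box k)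
    (cst ((2 ^+ k) ^+ p)%:E) r)%E).
  rewrite integral_cst//= [X in (_ * X)%E](_ : _ = ((2 ^- k.+1) ^+ p)%:E); last first.
    rewrite /completed_lebesgue_tuple /completed_measure_extension /=.
    rewrite measurable_mu_extE; first exact: measure_dyadic_box.
    exact: measurable_dyadic_box.
  rewrite -EFinM lee_fin -exprMn exprS invfM mulrCA divff ?mulr1 ?expf_neq0//.
  by rewrite exprVn.
apply: ge0_le_integral => //.
- by move=> r rk; rewrite /= lee_fin exprn_ge0// exprn_ge0.
- apply: measurable_density_cara; first exact: dyadic_box_sub_cube.
  exact: measurable_dyadic_box.
- move=> r rk; rewrite lee_fin.
  rewrite [leLHS](_ : _ = \prod_(j < p) 2 ^+ k); last by rewrite prodr_const card_ord.
  apply: ler_prod => j _; rewrite exprn_ge0//=.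
  have /dyadic_itvE/andP[h1 h2] := rk j.
  have h3 : 0 < 2 ^- k.+1 :> R by rewrite invr_gt0 exprn_gt0.
  by rewrite -[leLHS]invrK lef_pV2 ?posrE ?invr_gt0 ?exprn_gt0//; lra.
Qed.

(** Whatever r0 is, all boxes close enough to the corner lie in [triangle r0]; infinitely many
    disjoint ones, each of logarithmic measure at least 2^(-p), have infinite total. *)
Lemma dyadic_corner_notin_Upsilon : (0 < p)%N -> ~ Upsilon dyadic_corner.
Proof.
move=> p0 [_ _ [r0 r0c]]; apply/negP; rewrite -leNgt.
have [K KP] : exists K, forall j, 2 ^- K <= 1 - tnth r0 j :> R.
  have /choice[K KP] : forall j : 'I_p, exists K, 2 ^- K <= 1 - tnth r0 j :> R.
    move=> j; have d0 : 0 < 1 - tnth r0 j by have := r0c j; lra.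
    exists (Num.truncn (1 - tnth r0 j)^-1).+1.
    rewrite -[leRHS]invrK lef_pV2 ?posrE ?invr_gt0 ?exprn_gt0//.
    apply: ltW; apply: lt_le_trans (truncnS_gt _) _.
    by rewrite -natrX ler_nat ltnW// ltn_expl.
  (* The sum serves as a common upper bound of the K j. *)
  exists (\sum_j K j)%N => j; apply: le_trans (KP j).
  by rewrite lef_pV2 ?posrE ?exprn_gt0// ler_eXn2l ?ltr1n// (bigD1 j)//= leq_addr.
pose F k := dyadic_box (K.+1 + k).
have Fsub : \bigcup_k F k `<=` dyadic_corner `&` triangle r0.
  move=> r [k _ rk]; split; first by exists (K + k)%N.
  split; first exact: dyadic_box_sub_cube rk.
  move=> j; have /dyadic_itvE/andP[_ h2] := rk j.
  have : 2 ^- (K.+1 + k) <= 2 ^- K :> R.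
    rewrite lef_pV2 ?posrE ?exprn_gt0// ler_eXn2l ?ltr1n//.
    by rewrite addSn ltnW// ltnS leq_addr.
  by have := KP j; lra.
have mF k : measurable (F k) by exact: measurable_dyadic_box.
have mD : measurable (dyadic_corner `&` triangle r0).
  by apply: measurableI; [exact: measurable_dyadic_corner|exact: measurable_triangle].
have cD : dyadic_corner `&` triangle r0 `<=` unit_cube by move=> r [_ []].
have mU : measurable (\bigcup_k F k) by exact: bigcup_measurable.
have dens_ge0 r : unit_cube r -> (0%:E <= density r)%E.
  move=> rc; rewrite lee_fin prodr_ge0// => j _; rewrite invr_ge0.
  by have := rc j; lra.
apply: (@le_trans _ _ (log_measure (\bigcup_k F k))); last first.
  apply: ge0_subset_integral => //.
  - exact: caratheodory_measurable_mu_ext.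
  - exact: caratheodory_measurable_mu_ext.
  - exact: measurable_density_cara.
  - by move=> r /cD; exact: dens_ge0.
rewrite /log_measure ge0_integral_bigcup; first last.
- exact: trivIset_dyadic_box.
- by move=> r /Fsub/cD; exact: dens_ge0.
- by apply: measurable_density_cara => // r /Fsub/cD.
- by move=> k; exact: caratheodory_measurable_mu_ext.
rewrite leye_eq; apply/eqP/eqyP => A A0.
(* N boxes of measure at least 2^(-p) already exceed A. *)
pose N := (Num.truncn (A * 2 ^+ p)).+1.
apply: le_trans (nneseries_lim_ge N _); last first.
  move=> k _ _; apply: integral_ge0 => r rk; apply: dens_ge0.
  exact: dyadic_box_sub_cube rk.
apply: (@le_trans _ _ (\sum_(0 <= k < N) (2 ^- p)%:E)%E).
  rewrite sumEFin lee_fin sumr_const_nat subn0 -[leRHS]mulr_natl.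
  rewrite ler_pdivlMr ?exprn_gt0//.
  exact/ltW/truncnS_gt.
by apply: lee_sum => k _; exact: log_measure_dyadic_box_ge.
Qed.

End DyadicBoxes.

(** * The lower bound on dyadic boxes *)

Section LowerBound.
Context (R : realType) (p : nat).
Implicit Types (r : p.-tuple R) (b : p.-tuple nat -> R[i]).

(** [q] is (1 - r_j)^(-1/4); [kappa] is the fourth root of the constant 4 p in [ln_max_term_le]. *)
Local Notation q r j := (Num.sqrt (Num.sqrt (1 - tnth r j)^-1)).
Local Notation kappa := ((4 * p%:R : R) `^ 4^-1).

(** Parseval over a box beyond all thresholds [N0 j]: passing from b to the smaller [prod_coef] only
    lowers the sum of squares, which then factors by coordinate. *)
Lemma max_modulus_prod_ge b r : (forall j, 2^-1 <= tnth r j < 1) ->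
  (forall n, normc (prod_coef R n) <= normc (b n)) ->
  ((\prod_(j < p) (expR (-1) / 3 * (expR (- ln (tnth r j))^-1 * q r j ^+ 3)))%:E
   <= max_modulus b r)%E.
Proof.
move=> rI coef_le.
have r0 j : 0 <= tnth r j by have := rI j; lra.
have /choice[N0 N0P] := fun j => sqrt_coef_l2_ge (rI j).
pose N := (\sum_j N0 j)%N.
apply: le_trans (max_modulus_ge b r0 (box_seq_uniq p N)).
set T := fun j => expR (-1) / 3 * (expR (- ln (tnth r j))^-1 * q r j ^+ 3).
have T0 j : 0 <= T j by rewrite !mulr_ge0 ?invr_ge0 ?expR_ge0 ?exprn_ge0 ?sqrtr_ge0.
have T_ge0 : 0 <= \prod_(j < p) T j by exact: prodr_ge0.
rewrite lee_fin -(ger0_norm T_ge0) -sqrtr_sqr ler_wsqrtr//.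
apply: (@le_trans _ _ (\sum_(n <- box_seq p N)
    \prod_(j < p) (sqrt_coef R (tnth n j) * tnth r j ^+ tnth n j) ^+ 2)).
  rewrite (sum_box_seq N (fun j i => (sqrt_coef R i * tnth r j ^+ i) ^+ 2)).
  rewrite -prodrXl; apply: ler_prod => j _; rewrite sqr_ge0/=.
  by apply: N0P; rewrite /N (bigD1 j)//= leq_addr.
apply: ler_sum => n _; rewrite prodrXl -prod_coef_rmonom.
rewrite ler_sqr ?nnegrE ?mulr_ge0 ?normc_ge0 ?rmonom_ge0//.
by rewrite ler_wpM2r ?rmonom_ge0.
Qed.

Lemma dyadic_box_half r k : dyadic_box k.+1 r -> forall j, 2^-1 <= tnth r j < 1.
Proof.
move=> rk j; have /dyadic_itvE/andP[h1 h2] := rk j.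
have h3 : 0 < 2 ^- k.+2 :> R by rewrite invr_gt0 exprn_gt0.
have h4 : 2 ^- k.+1 <= 2^-1 :> R.
  by rewrite lef_pV2 ?posrE ?exprn_gt0// ler_eXnr// ler1n.
by apply/andP; split; lra.
Qed.

(** Each coordinate contributes 1/s_j + ln (1 / (1 - r_j)) at most, where 1/s_j <= 1 / (1 - r_j) <=
    2 * 2^(k+1) and u <= exp u. *)
Lemma ln_max_term_le r k : dyadic_box k.+1 r ->
  0 <= ln (max_term (@prod_coef R p) r * \prod_(j < p) (1 - tnth r j)^-1)
    <= 4 * p%:R * 2 ^+ k.+1.
Proof.
move=> rk; have rI := dyadic_box_half rk.
have rI' j : 0 < tnth r j < 1 by have := rI j; lra.
have /andP[mu1 mu2] := max_term_prod_coef rI'.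
have prod1 : 1 <= \prod_(j < p) (1 - tnth r j)^-1.
  apply: (big_ind (fun x : R => 1 <= x)) => // [|j _]; first exact: mulr_ege1.
  by rewrite invf_ge1; have := rI j; lra.
apply/andP; split; first by rewrite ln_ge0// mulr_ege1.
rewrite -[leRHS]expRK ler_ln ?posrE ?expR_gt0//; last first.
  by rewrite (lt_le_trans ltr01)// mulr_ege1.
apply: (@le_trans _ _ (\prod_(j < p) expR (4 * 2 ^+ k.+1))); last first.
  by rewrite -expR_sum sumr_const card_ord ler_expR -[leLHS]mulr_natr mulrAC.
apply: (@le_trans _ _ (\prod_(j < p) (expR (- ln (tnth r j))^-1 * (1 - tnth r j)^-1))).
  by rewrite big_split /= ler_wpM2r// (le_trans ler01).
apply: ler_prod => j _.
have d0 : 0 < 1 - tnth r j by have := rI j; lra.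
have /andP[s1 _] := oppr_ln_itv (rI j).
have dk : (1 - tnth r j)^-1 <= 2 * 2 ^+ k.+1.
  have /dyadic_itvE/andP[/ltW h1 _] := rk j.
  by rewrite -exprS -[leRHS]invrK lef_pV2 ?posrE ?invr_gt0 ?exprn_gt0.
rewrite mulr_ge0 ?expR_ge0 ?invr_ge0 ?(ltW d0)//=.
rewrite (_ : 4 * 2 ^+ k.+1 = 2 * 2 ^+ k.+1 + 2 * 2 ^+ k.+1); last by ring.
rewrite expRD; apply: ler_pM; rewrite ?expR_ge0 ?invr_ge0 ?(ltW d0)//.
  rewrite ler_expR; apply: le_trans dk.
  by rewrite lef_pV2 ?posrE//; lra.
by apply: le_trans dk _; apply: le_trans (expR_ge1Dx _); lra.
Qed.

(** The power p/4 of 4 p 2^(k+1) is a product of p equal factors, and 2^(k+1) <= 1 / (1 - r_j) for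
    every j: here the common scale of the coordinates matters. *)
Lemma ln_max_term_powR_le r k : dyadic_box k.+1 r ->
  ln (max_term (@prod_coef R p) r * \prod_(j < p) (1 - tnth r j)^-1) `^ (p%:R / 4)
  <= \prod_(j < p) (kappa * q r j).
Proof.
move=> rk; have /andP[L0 LB] := ln_max_term_le rk.
have B0 : 0 <= 4 * p%:R * 2 ^+ k.+1 :> R by rewrite !mulr_ge0 ?exprn_ge0.
have pw0 : 0 <= p%:R / 4 :> R by rewrite divr_ge0.
apply: (le_trans (ge0_ler_powR pw0 _ _ LB)); rewrite ?nnegrE//.
rewrite [p%:R / 4]mulrC powRrM powR_mulrn ?powR_ge0//.
rewrite -[p in _ ^+ p](card_ord p) -prodr_const.
apply: ler_prod => j _; rewrite powR_ge0 [leLHS]powRM ?mulr_ge0 ?exprn_ge0//=.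
rewrite ler_wpM2l ?powR_ge0//.
have d0 : 0 < (1 - tnth r j)^-1.
  by rewrite invr_gt0; have := dyadic_box_half rk j; lra.
have q4 : q r j ^+ 4 = (1 - tnth r j)^-1.
  by rewrite (exprM _ 2 2) sqr_sqrtr ?sqrtr_ge0// sqr_sqrtr// ltW.
have -> : q r j = (q r j ^+ 4) `^ 4^-1.
  by rewrite -powR_mulrn ?sqrtr_ge0// -powRrM mulfV// powRr1 ?sqrtr_ge0.
rewrite q4; apply: ge0_ler_powR; rewrite ?nnegrE ?invr_ge0 ?exprn_ge0//.
  by rewrite -invr_ge0 ltW.
have /dyadic_itvE/andP[_ h2] := rk j.
by rewrite -[leLHS]invrK lef_pV2 ?posrE ?invr_gt0 ?exprn_gt0// -invr_gt0.
Qed.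

(** Per coordinate, exp (-1) / 3 is the loss in [sqrt_coef_l2_ge] and [kappa] the loss in the
    logarithm. *)
Definition lower_constant : R := (expR (-1) / (3 * kappa)) ^+ p.

Lemma lower_constant_gt0 : (0 < p)%N -> 0 < lower_constant.
Proof.
move=> p0; rewrite exprn_gt0// divr_gt0 ?expR_gt0// mulr_gt0// powR_gt0//.
by rewrite mulr_gt0// ltr0n.
Qed.

Lemma max_modulus_dyadic_corner_ge b r : (0 < p)%N -> dyadic_corner r ->
  (forall n, normc (prod_coef R n) <= normc (b n)) ->
  ((lower_constant * max_term (@prod_coef R p) r *
    \prod_(j < p) (Num.sqrt (1 - tnth r j))^-1 *
    ln (max_term (@prod_coef R p) r * \prod_(j < p) (1 - tnth r j)^-1)
      `^ (p%:R / 4))%:E <= max_modulus b r)%E.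
Proof.
move=> p0 [k _ rk] coef_le; have rI := dyadic_box_half rk.
apply: le_trans (max_modulus_prod_ge rI coef_le); rewrite lee_fin.
have rI' j : 0 < tnth r j < 1 by have := rI j; lra.
have /andP[mu1 mu2] := max_term_prod_coef rI'.
have k0 : 0 < kappa by rewrite powR_gt0// mulr_gt0// ltr0n.
apply: (@le_trans _ _ (lower_constant * (\prod_(j < p) expR (- ln (tnth r j))^-1) *
    \prod_(j < p) (Num.sqrt (1 - tnth r j))^-1 * \prod_(j < p) (kappa * q r j))).
  have S0 : 0 <= \prod_(j < p) (Num.sqrt (1 - tnth r j))^-1.
    by apply: prodr_ge0 => j _; rewrite invr_ge0 sqrtr_ge0.
  have C0 := ltW (lower_constant_gt0 p0).
  have mu0 : 0 <= max_term (@prod_coef R p) r by rewrite (le_trans ler01).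
  apply: ler_pM; rewrite ?powR_ge0 ?mulr_ge0//; last exact: ln_max_term_powR_le rk.
  by rewrite ler_wpM2r// ler_wpM2l.
(* What remains is an equality in each coordinate: q^2 from the square root times q from the
   logarithm is q^3, and [kappa] cancels. *)
rewrite le_eqVlt; apply/orP; left; apply/eqP.
have -> : lower_constant = \prod_(j < p) (expR (-1) / (3 * kappa)).
  by rewrite prodr_const card_ord.
rewrite -!big_split /=.
apply: eq_bigr => j _.
have -> : (Num.sqrt (1 - tnth r j))^-1 = q r j ^+ 2.
  by rewrite sqr_sqrtr ?sqrtr_ge0// sqrtrV//; have := rI j; lra.
by field; rewrite gt_eqF.
Qed.

End LowerBound.

(** * From almost every t to the deterministic bound *)

Theorem theorem2p4 (R : realType) (p : nat) (p_ge2 : (2 <= p)%N)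
    (Z : p.-tuple nat -> lebesgueType R -> R[i])
    (Z_rv : forall n, complex_random_variable (Z n))
    (Z_ge1 : forall n, {ae @completed_lebesgue_measure R,
      forall t, unit_interval R t -> 1 <= normc (Z n t)}) :
  exists2 a : p.-tuple nat -> R[i], classA a &
  exists2 C : R, 0 < C &
  {ae @completed_lebesgue_measure R, forall t, unit_interval R t ->
    exists E : set (p.-tuple R),
      [/\ E `<=` unit_cube, lebesgue_measurable E, ~ Upsilon E &
        forall r, E r ->
          ((C * max_term a r * \prod_(j < p) (Num.sqrt (1 - tnth r j))^-1 *
            ln (max_term a r * \prod_(j < p) (1 - tnth r j)^-1) `^ (p%:R / 4))%:E
           <= max_modulus (fun n => (a n * Z n t)%R) r)%E]}.
Proof.
have p0 : (0 < p)%N by exact: ltnW.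
exists (@prod_coef R p); first exact: prod_coef_classA.
exists (lower_constant R p); first exact: lower_constant_gt0.
(* Multi-indices are countable, so one null set serves for all n; codes k of no multi-index carry a
   trivial condition. *)
have Z_all : {ae @completed_lebesgue_measure R, forall t, forall k : nat,
    unit_interval R t -> if unpickle k is Some n then 1 <= normc (Z n t) else true}.
  apply: ae_foralln => k; case: (unpickle k) => [n|]; first exact: Z_ge1.
  by apply: filterE.
(* The same set E works for all such t. *)
apply: filterS Z_all => t Zt tI; exists (@dyadic_corner R p); split.
- exact: dyadic_corner_sub_cube.
- exact: dyadic_corner_lebesgue_measurable.
- exact: dyadic_corner_notin_Upsilon.
move=> r rE; apply: max_modulus_dyadic_corner_ge => // n.
have := Zt (pickle n) tI; rewrite pickleK => Zn.
by rewrite normcM ler_peMr// normc_ge0.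
Qed.
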